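(* Let $|\psi\rangle_A$ and $|\psi\rangle_C$ be arbitrary single-qubit pure states (not necessarily equal) of the data qubits at nodes $A$ and $C$, and let $U$ be an arbitrary single-qubit unitary. Suppose nodes $A$, $B$, $C$ execute the following protocol, where $A$ holds an ancilla $A_e$, $B$ holds ancillas $B_{e1},B_{e2}$, and $C$ holds an ancilla $C_e$. Phase 1 (entanglement swapping): the Bell pairs $|\Phi^+\rangle_{A_eB_{e1}}$ and $|\Phi^+\rangle_{C_eB_{e2}}$ are created; node $B$ performs a Bell-state measurement on $(B_{e1},B_{e2})$ and sends the result to $C$; node $C$ applies to $C_e$ the Pauli correction determined by the result. Phase 2 (gate teleportation): the SCST protocol is executed with control data qubit $A$, target data qubit $C$, unitary $U$, and the pair $(A_e,C_e)$ as its Bell-pair resource. Then, for every sequence of measurement outcomes, the final state of the data qubits $A$ and $C$ is, up to a global phase, $$\mathrm{C}\text{-}U_{A,C}\,\bigl(|\psi\rangle_A\otimes|\psi\rangle_C\bigr),$$ where $\mathrm{C}\text{-}U_{A,C}=|0\rangle\langle 0|_A\otimes I_C+|1\rangle\langle 1|_A\otimes U_C$.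
   Context: Bell states: $|\Phi^\pm\rangle=\tfrac{1}{\sqrt2}(|00\rangle\pm|11\rangle)$ and $|\Psi^\pm\rangle=\tfrac{1}{\sqrt2}(|01\rangle\pm|10\rangle)$. A Bell-state measurement is the projective measurement in this basis. Its result is encoded by two bits $(m_1,m_2)$, with $\Phi^+\leftrightarrow(0,0)$, $\Phi^-\leftrightarrow(1,0)$, $\Psi^+\leftrightarrow(0,1)$, $\Psi^-\leftrightarrow(1,1)$. The Pauli correction applied to $C_e$ is $X^{m_2}Z^{m_1}$. SCST (single-control single-target) protocol with control data qubit $A$, target data qubit $C$, unitary $U$ and resource qubits $(A_e,C_e)$ (with $A_e$ at node $A$ and $C_e$ at node $C$), meant to be used when $(A_e,C_e)$ is in the state $|\Phi^+\rangle$: (i) apply CNOT with control $A$ and target $A_e$; (ii) measure $A_e$ in the computational basis, and if the result is $1$ apply $X$ to $C_e$; (iii) apply the controlled-$U$ gate with control $C_e$ and target $C$; (iv) apply a Hadamard gate to $C_e$; (v) measure $C_e$ in the computational basis, and if the result is $1$ apply $Z$ to $A$. *)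

(* Defs.v *)
From mathcomp Require Import all_boot all_order all_algebra.
From mathcomp.real_closed Require Export complex mxtens.
From mathcomp Require Export reals.

Set Implicit Arguments.
Unset Strict Implicit.
Unset Printing Implicit Defensive.

Import GRing.Theory Num.Theory.
Local Open Scope ring_scope.
Local Open Scope sesquilinear_scope.

Section Vectors.
Variable K : numClosedFieldType.

Definition bit (b : bool) : 'I_2 := if b then 1 else 0.

Definition ket (b : bool) : 'cV[K]_2 := delta_mx (bit b) 0.

Definition ket2 (b1 b2 : bool) : 'cV[K]_(2 * 2) := ket b1 *t ket b2.

(* The projector |v><v|, for a unit vector v. *)
Definition proj n (v : 'cV[K]_n) : 'M[K]_n := v *m v ^t*.

Definition unit_ket n (v : 'cV[K]_n) : Prop := \sum_i `|v i 0| ^+ 2 = 1.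

Definition eq_up_to_phase n (v w : 'cV[K]_n) : Prop :=
  exists2 z : K, `|z| = 1 & v = z *: w.

Definition PhiP : 'cV[K]_(2 * 2) :=
  (sqrtC 2)^-1 *: (ket2 false false + ket2 true true).
Definition PhiM : 'cV[K]_(2 * 2) :=
  (sqrtC 2)^-1 *: (ket2 false false - ket2 true true).
Definition PsiP : 'cV[K]_(2 * 2) :=
  (sqrtC 2)^-1 *: (ket2 false true + ket2 true false).
Definition PsiM : 'cV[K]_(2 * 2) :=
  (sqrtC 2)^-1 *: (ket2 false true - ket2 true false).

Definition bell (m1 m2 : bool) : 'cV[K]_(2 * 2) :=
  match m1, m2 with
  | false, false => PhiP
  | true, false => PhiM
  | false, true => PsiP
  | true, true => PsiM
  end.

Definition pauliX : 'M[K]_2 := \matrix_(i, j) (i != j)%:R.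
Definition pauliZ : 'M[K]_2 := \matrix_(i, j) ((-1) ^+ i *+ (i == j)).
Definition hadamard : 'M[K]_2 :=
  (sqrtC 2)^-1 *: \matrix_(i, j) (-1) ^+ (i * j).

(* The first tensor factor is the control. *)
Definition ctrl (U : 'M[K]_2) : 'M[K]_(2 * 2) :=
  proj (ket false) *t 1%:M + proj (ket true) *t U.
Definition CNOT : 'M[K]_(2 * 2) := ctrl pauliX.

End Vectors.

(* A pure state of the qubits in Q is given by its amplitudes in the
   computational basis, whose vectors are the labellings x : {ffun Q -> 'I_2}. *)
Section Register.
Variables (K : numClosedFieldType) (Q : finType).

Definition label := {ffun Q -> 'I_2}.
Definition state := {ffun label -> K}.

Implicit Types (q : Q) (x : label) (psi : state).

Definition set_bit x q (b : 'I_2) : label :=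
  [ffun p => if p == q then b else x p].

(* G acting on qubit q, tensored with the identity on the other qubits. *)
Definition app1 (G : 'M[K]_2) q psi : state :=
  [ffun x : label => \sum_b G (x q) b * psi (set_bit x q b)].

(* Likewise for G acting on the qubits q1 (first tensor factor) and q2; only
   meaningful for q1 != q2. *)
Definition app2 (G : 'M[K]_(2 * 2)) q1 q2 psi : state :=
  [ffun x : label => \sum_b1 \sum_b2
     G (mxtens_index (x q1, x q2)) (mxtens_index (b1, b2))
     * psi (set_bit (set_bit x q1 b1) q2 b2)].

Definition state_norm psi : K := sqrtC (\sum_x `|psi x| ^+ 2).

(* Since 0^-1 = 0, an outcome of probability zero leads to the state 0, which
   is not a unit vector. *)
Definition normalize psi : state := [ffun x : label => psi x / state_norm psi].

(* The state after a measurement of q in the computational basis with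
   outcome m. *)
Definition measure_comp q (m : bool) psi : state :=
  normalize (app1 (proj (ket K m)) q psi).

(* The state after a Bell-state measurement of (q1, q2) with outcome (m1, m2). *)
Definition measure_bell q1 q2 (m1 m2 : bool) psi : state :=
  normalize (app2 (proj (bell K m1 m2)) q1 q2 psi).

(* The density matrix of the pair (q1, q2), for q1 != q2: the partial trace of
   |psi><psi| over all the other qubits. Its (i, j) entry sums
   <i,e|psi><psi|j,e> over the labellings e of the other qubits, where x is the
   combined label (i,e). *)
Definition reduced q1 q2 psi : 'M[K]_(2 * 2) :=
  \matrix_(i, j) \sum_(x : label | mxtens_index (x q1, x q2) == i)
    psi x * (psi (set_bit (set_bit x q1 (mxtens_unindex j).1)
                          q2 (mxtens_unindex j).2))^*.

(* What B and C do once the Bell pairs on (Ae, Be1) and (Ce, Be2) exist. *)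
Definition swapping Be1 Be2 Ce (m1 m2 : bool) psi : state :=
  app1 (pauliX K ^+ m2 * pauliZ K ^+ m1) Ce (measure_bell Be1 Be2 m1 m2 psi).

(* a and c are the outcomes of the measurements of Ae and Ce. *)
Definition SCST A C Ae Ce (U : 'M[K]_2) (a c : bool) psi : state :=
  let psi1 := app2 (CNOT K) A Ae psi in
  let psi2 := measure_comp Ae a psi1 in
  let psi3 := if a then app1 (pauliX K) Ce psi2 else psi2 in
  let psi4 := app2 (ctrl U) Ce C psi3 in
  let psi5 := app1 (hadamard K) Ce psi4 in
  let psi6 := measure_comp Ce c psi5 in
  if c then app1 (pauliZ K) A psi6 else psi6.

End Register.

Section Protocol.
Variable K : numClosedFieldType.

Definition qA   : 'I_6 := @Ordinal 6 0 isT.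
Definition qAe  : 'I_6 := @Ordinal 6 1 isT.
Definition qBe1 : 'I_6 := @Ordinal 6 2 isT.
Definition qBe2 : 'I_6 := @Ordinal 6 3 isT.
Definition qCe  : 'I_6 := @Ordinal 6 4 isT.
Definition qC   : 'I_6 := @Ordinal 6 5 isT.

(* |psiA>_A |Phi+>_{Ae Be1} |Phi+>_{Ce Be2} |psiC>_C *)
Definition initial (psiA psiC : 'cV[K]_2) : state K 'I_6 :=
  [ffun x : label 'I_6 => psiA (x qA) 0
            * PhiP K (mxtens_index (x qAe, x qBe1)) 0
            * PhiP K (mxtens_index (x qCe, x qBe2)) 0
            * psiC (x qC) 0].

Definition final (U : 'M[K]_2) (psiA psiC : 'cV[K]_2) (m1 m2 a c : bool) :
    state K 'I_6 :=
  SCST qA qC qAe qCe U a c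
    (swapping qBe1 qBe2 qCe m1 m2 (initial psiA psiC)).

End Protocol.

(* Main.v *)
Require Import Defs.
From mathcomp Require Import all_boot all_order all_algebra.
From mathcomp Require Import ring.
Import GRing.Theory Num.Theory.
Local Open Scope ring_scope.

(** Before normalization every intermediate state is, up to a nonzero scalar,
    an explicit function of the label x. With b the Bell amplitudes of the
    outcome (m1, m2), the successive amplitudes are
      after swapping:   b(Be1,Be2) [Ae = Ce] psiA(A) psiC(C),
      after step (ii):  [Ae = a] b(Be1,Be2) [Ce = A] psiA(A) psiC(C),
      after step (iv):  [Ae = a] b(Be1,Be2) (-1)^(Ce A) chi(A,C),
      at the end:       [Ae = a] b(Be1,Be2) [Ce = c] chi(A,C),
    where chi = C-U (psiA (x) psiC). In the last one A and C are decoupled from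
    the other qubits, so tracing those out leaves a multiple of |chi><chi|, and
    the multiple is 1 because the state is normalized. *)

Set Implicit Arguments.
Unset Strict Implicit.
Unset Printing Implicit Defensive.

(** * Case analysis and sums over bits and tensor indices *)

Lemma ord2_ind (P : 'I_2 -> Prop) : P 0 -> P 1 -> forall i, P i.
Proof.
move=> P0 P1 [[|[|//]] i_lt].
  by rewrite (_ : Ordinal _ = 0) //; exact: val_inj.
by rewrite (_ : Ordinal _ = 1) //; exact: val_inj.
Qed.

Lemma big_ord2 (V : nmodType) (F : 'I_2 -> V) : \sum_i F i = F 0 + F 1.
Proof.
by rewrite !big_ord_recl big_ord0 addr0; congr (F _ + F _); apply: val_inj.
Qed.

Lemma mxtens_index_bij m n : bijective (@mxtens_index m n).
Proof. exact: Bijective (@mxtens_indexK m n) (@mxtens_unindexK m n). Qed.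

Lemma big_mxtens_index (V : nmodType) m n (F : 'I_(m * n) -> V) :
  \sum_i F i = \sum_(i < m) \sum_(j < n) F (mxtens_index (i, j)).
Proof.
rewrite (reindex _ (onW_bij _ (mxtens_index_bij m n))) pair_big /=.
by apply: eq_bigr => -[].
Qed.

(** * Amplitudes up to a nonzero scalar *)

Section Propto.
Variables (K : numClosedFieldType) (Q : finType).
Implicit Types (psi : state K Q) (F : label Q -> K).

(** Each measurement rescales the state, so the scalar is left unspecified; [k != 0] keeps [psi]
    nonzero whenever [F] is. *)
Definition propto psi F := exists2 k, k != 0 & forall x, psi x = k * F x.

(** By linearity the unknown scalar of [psi] passes through the gate, which leaves an identity
    between explicit amplitudes; [k] absorbs constants such as the factor of the Hadamard gate. *)
Lemma propto_app1 psi F F' (G : 'M_2) q k : k != 0 ->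
    (forall x : label Q, \sum_b G (x q) b * F (set_bit x q b) = k * F' x) ->
  propto psi F -> propto (app1 G q psi) F'.
Proof.
move=> k0 FF' [l l0 psiF]; exists (l * k); first exact: mulf_neq0.
move=> x; rewrite ffunE -mulrA -FF' mulr_sumr.
by apply: eq_bigr => b _; rewrite psiF mulrCA.
Qed.

Lemma propto_app2 psi F F' (G : 'M_(2 * 2)) q1 q2 k : k != 0 ->
    (forall x : label Q, \sum_b1 \sum_b2
       G (mxtens_index (x q1, x q2)) (mxtens_index (b1, b2))
       * F (set_bit (set_bit x q1 b1) q2 b2) = k * F' x) ->
  propto psi F -> propto (app2 G q1 q2 psi) F'.
Proof.
move=> k0 FF' [l l0 psiF]; exists (l * k); first exact: mulf_neq0.
move=> x; rewrite ffunE -mulrA -FF' mulr_sumr; apply: eq_bigr => b1 _.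
by rewrite mulr_sumr; apply: eq_bigr => b2 _; rewrite psiF mulrCA.
Qed.

(* No nonvanishing assumption: the zero state is left fixed by normalize. *)
Lemma propto_normalize psi F : propto psi F -> propto (normalize psi) F.
Proof.
move=> [l l0 psiF]; have [n0|n0] := eqVneq (state_norm psi) 0.
  exists l => // x; rewrite ffunE n0 invr0 mulr0 -psiF.
  move/eqP: n0; rewrite sqrtC_eq0 psumr_eq0; last by move=> *; exact: exprn_ge0.
  by move/allP/(_ x); rewrite mem_index_enum sqrf_eq0 normr_eq0 => /(_ isT)/eqP.
exists (l / state_norm psi); first by rewrite mulf_neq0 ?invr_eq0.
by move=> x; rewrite ffunE psiF mulrAC.
Qed.

(** Recovers the modulus that [propto] forgets: the norm of [psi] is [|l|] times that of [F], so
    dividing by it leaves only the phase of [l] undetermined. *)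
Lemma normalize_propto psi F :
    propto psi F -> \sum_x `|F x| ^+ 2 != 0 ->
  exists2 k, `|k| ^+ 2 * (\sum_x `|F x| ^+ 2) = 1 &
             forall x, normalize psi x = k * F x.
Proof.
move=> [l l0 psiF]; set N := \sum_x _ => N0; exists (l / state_norm psi).
  have N_ge0 : 0 <= N by apply: sumr_ge0 => x _; exact: exprn_ge0.
  have normE : state_norm psi ^+ 2 = `|l| ^+ 2 * N.
    rewrite sqrtCK mulr_sumr; apply: eq_bigr => x _.
    by rewrite psiF normrM exprMn.
  have n_ge0 : 0 <= state_norm psi.
    by rewrite sqrtC_ge0 sumr_ge0 // => x _; exact: exprn_ge0.
  rewrite normrM normfV (ger0_norm n_ge0) expr_div_n normE.
  by rewrite mulrAC mulfV // mulf_neq0 // expf_neq0 // normr_eq0.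
by move=> x; rewrite ffunE psiF mulrAC.
Qed.

End Propto.

(** * Entries of kets, projectors and gates *)

Section Entries.
Variable K : numClosedFieldType.

Lemma unit_ketE n (v : 'cV[K]_n) : unit_ket v <-> (v ^t*)%sesqui *m v = 1%:M.
Proof.
have vvE : ((v ^t*)%sesqui *m v) 0 0 = \sum_i `|v i 0| ^+ 2.
  by rewrite mxE; apply: eq_bigr => i _; rewrite !mxE normCKC.
rewrite /unit_ket -vvE; split=> [vv1|->]; last by rewrite mxE.
by apply/matrixP=> i j; rewrite !ord1 vv1 mxE.
Qed.

Lemma unit_ket_unitary n (V : 'M[K]_n) v :
  V \is unitarymx -> unit_ket v -> unit_ket (V *m v).
Proof.
move=> /unitarymxP/mulmx1C VV1 /unit_ketE vv1; apply/unit_ketE.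
by rewrite trmx_mul map_mxM -mulmxA (mulmxA _ V) VV1 mul1mx.
Qed.

Lemma ketE b i : ket K b i 0 = (i == bit b)%:R.
Proof. by rewrite mxE eqxx andbT. Qed.

Lemma tens_cvE m n (u : 'cV[K]_m) (v : 'cV[K]_n) i j :
  (u *t v : 'cV_(m * n)) (mxtens_index (i, j)) 0 = u i 0 * v j 0.
Proof.
rewrite -[in RHS](tensmxE u v); congr (_ _ _); exact: val_inj.
Qed.

Lemma proj_ketE b i j : proj (ket K b) i j = ((i == bit b) && (j == bit b))%:R.
Proof.
by rewrite mxE big_ord1 ketE !mxE eqxx andbT conjC_nat -natrM mulnb.
Qed.

Lemma projE n (v : 'cV[K]_n) i j : proj v i j = v i 0 * (v j 0)^*.
Proof. by rewrite mxE big_ord1 !mxE. Qed.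

(* The amplitudes of sqrt 2 times a Bell state. *)
Definition bell_amp (m1 m2 : bool) (i j : 'I_2) : K :=
  (j == i + bit m2)%:R * (-1) ^+ (m1 * i).

Lemma ket2E b1 b2 i j :
  ket2 K b1 b2 (mxtens_index (i, j)) 0 = ((i == bit b1) && (j == bit b2))%:R.
Proof. by rewrite tens_cvE !ketE -natrM mulnb. Qed.

Lemma bellE m1 m2 i j :
  bell K m1 m2 (mxtens_index (i, j)) 0 = (sqrtC 2)^-1 * bell_amp m1 m2 i j.
Proof.
rewrite /bell_amp; case: m1; case: m2;
  rewrite [LHS]mxE [X in _ * X]mxE ?[fun_of_matrix (- _) _ _]mxE !ket2E;
  congr (_ * _);
  by move: i j; do 2![apply: ord2_ind] => /=; ring.
Qed.

Lemma ctrlE (U : 'M[K]_2) i j k l :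
  ctrl U (mxtens_index (i, j)) (mxtens_index (k, l)) =
  (i == k)%:R * (if i == 0 then (j == l)%:R else U j l).
Proof.
rewrite mxE !tensmxE !proj_ketE mxE.
by move: i k; do 2![apply: ord2_ind] => /=; ring.
Qed.

Lemma pauliE (m1 m2 : bool) i j : (pauliX K ^+ m2 * pauliZ K ^+ m1) i j =
  (i == j + bit m2)%:R * (-1) ^+ (m1 * j).
Proof.
case: m1; case: m2; rewrite ?expr0 ?expr1 ?mulr1 ?mul1r ?mxE ?big_ord2 ?mxE;
  by move: i j; do 2![apply: ord2_ind] => /=; rewrite ?mulr0n ?mulr1n; ring.
Qed.

Lemma normr_bell_amp m1 m2 i j :
  `|bell_amp m1 m2 i j| ^+ 2 = (j == i + bit m2)%:R.
Proof.
rewrite normrM normr_nat normrX normrN1 expr1n mulr1 -natrX.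
by rewrite expnS expn1 mulnb andbb.
Qed.

Lemma conj_bell m1 m2 i j : (bell K m1 m2 (mxtens_index (i, j)) 0)^* =
  bell K m1 m2 (mxtens_index (i, j)) 0.
Proof.
rewrite bellE /bell_amp !rmorphM fmorphV rmorph_nat rmorphXn rmorphN1.
by rewrite /= (CrealP _) // ger0_real // sqrtC_ge0.
Qed.

Lemma sqrtC2_neq0 : (sqrtC 2)^-1 != 0 :> K.
Proof. by rewrite invr_eq0 sqrtC_eq0 pnatr_eq0. Qed.

End Entries.

(** * The state along the protocol and its partial trace *)

Section Protocol.
Variable K : numClosedFieldType.
Implicit Types (psi : state K 'I_6) (x : label 'I_6) (psiA psiC : 'cV[K]_2).

Lemma initial_amp psiA psiC :
  propto (initial psiA psiC)
    (fun x => psiA (x qA) 0 * (x qAe == x qBe1)%:R * (x qCe == x qBe2)%:R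
              * psiC (x qC) 0).
Proof.
exists ((sqrtC 2)^-1 ^+ 2) => [|x]; first by rewrite expf_neq0 ?sqrtC2_neq0.
have PhiE i j : PhiP K (mxtens_index (i, j)) 0 = (sqrtC 2)^-1 * (i == j)%:R.
  by rewrite (bellE _ false false) /bell_amp addr0 mul0n expr0 mulr1 eq_sym.
by rewrite ffunE !PhiE; ring.
Qed.

(** Projecting (Be1, Be2) onto a Bell state copies its real amplitudes onto (Ae, Ce); the Pauli
    correction then turns that pair into [PhiP] up to sign. *)
Lemma swapping_amp psiA psiC (m1 m2 : bool) :
  propto (swapping qBe1 qBe2 qCe m1 m2 (initial psiA psiC))
    (fun x => bell_amp K m1 m2 (x qBe1) (x qBe2) * (x qAe == x qCe)%:R
              * (psiA (x qA) 0 * psiC (x qC) 0)).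
Proof.
have /propto_normalize : propto (app2 (proj (bell K m1 m2)) qBe1 qBe2
      (initial psiA psiC)) (fun x => bell_amp K m1 m2 (x qBe1) (x qBe2)
    * bell_amp K m1 m2 (x qAe) (x qCe) * (psiA (x qA) 0 * psiC (x qC) 0)).
  apply: (propto_app2 _ _ (initial_amp psiA psiC)).
    (* This also fixes [k]: the projector contributes one factor [(sqrtC 2)^-1] for each of its two
       Bell vectors. *)
    exact: (mulf_neq0 (sqrtC2_neq0 K) (sqrtC2_neq0 K)).
  move=> x; rewrite !big_ord2 !ffunE /= !projE !conj_bell !bellE.
  move: (bell_amp K m1 m2) (x qAe) (x qCe) => B.
  by do 2![apply: ord2_ind] => /=; ring.
(* Only the bit b = Ae + m2 of Ce contributes: the sign (-1)^(m1 b) of Z meets the sign (-1)^(m1 Ae)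
   of the Bell amplitude, leaving (-1)^(m1 m2). *)
apply: (propto_app1 (k := (-1) ^+ (m1 * m2))); first by rewrite signr_eq0.
move=> x; rewrite big_ord2 !ffunE /= !pauliE {2 4}/bell_amp.
move: (bell_amp K m1 m2 (x qBe1) (x qBe2)) => B; move: (x qAe) (x qCe).
by case: m1; case: m2; do 2![apply: ord2_ind] => /=; ring.
Qed.

Definition ctrl_amp (U : 'M[K]_2) psiA psiC i j : K :=
  (ctrl U *m (psiA *t psiC) : 'cV_(2 * 2)) (mxtens_index (i, j)) 0.

(** C-U is block diagonal in the control bit, so the amplitude of [psiA] factors out. *)
Lemma ctrl_ampE U psiA psiC i j : ctrl_amp U psiA psiC i j = psiA i 0 *
  \sum_l (if i == 0 then (j == l)%:R else U j l) * psiC l 0.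
Proof.
rewrite /ctrl_amp mxE big_mxtens_index.
under eq_bigr do under eq_bigr do rewrite tens_cvE ctrlE.
rewrite !big_ord2; move: i; apply: ord2_ind => /=; ring.
Qed.

Lemma teleport_amp U psiA psiC (m1 m2 a : bool) psi :
    propto psi (fun x => bell_amp K m1 m2 (x qBe1) (x qBe2)
      * (x qAe == x qCe)%:R * (psiA (x qA) 0 * psiC (x qC) 0)) ->
  let psi1 := app2 (CNOT K) qA qAe psi in
  let psi2 := measure_comp qAe a psi1 in
  let psi3 := if a then app1 (pauliX K) qCe psi2 else psi2 in
  propto (app1 (hadamard K) qCe (app2 (ctrl U) qCe qC psi3))
    (fun x => (x qAe == bit a)%:R * bell_amp K m1 m2 (x qBe1) (x qBe2)
      * (-1) ^+ (x qCe * x qA) * ctrl_amp U psiA psiC (x qA) (x qC)).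
Proof.
set B := bell_amp K m1 m2 => psi_amp /=.
have cnot_amp : propto (app2 (CNOT K) qA qAe psi)
    (fun x => B (x qBe1) (x qBe2) * (x qAe + x qA == x qCe)%:R
              * (psiA (x qA) 0 * psiC (x qC) 0)).
  apply: (propto_app2 (oner_neq0 K) _ psi_amp) => x.
  rewrite !big_ord2 !ffunE /= !ctrlE !mxE.
  move: (B _ _) (x qA) (x qAe) (x qCe) => b.
  by do 3![apply: ord2_ind] => /=; ring.
have /propto_normalize meas_amp :
    propto (app1 (proj (ket K a)) qAe (app2 (CNOT K) qA qAe psi))
      (fun x => (x qAe == bit a)%:R * B (x qBe1) (x qBe2)
         * (x qA + bit a == x qCe)%:R * (psiA (x qA) 0 * psiC (x qC) 0)).
  apply: (propto_app1 (oner_neq0 K) _ cnot_amp) => x.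
  rewrite !big_ord2 !ffunE /= !proj_ketE.
  move: (B _ _) (x qA) (x qAe) (x qCe) => b.
  by case: a; do 3![apply: ord2_ind] => /=; ring.
set psi3 := (if a then _ else _).
have psi3_amp : propto psi3 (fun x => (x qAe == bit a)%:R
      * B (x qBe1) (x qBe2) * (x qA == x qCe)%:R
      * (psiA (x qA) 0 * psiC (x qC) 0)).
  rewrite /psi3; case: a meas_amp {psi3} => [meas_amp|]; last first.
    by under [X in propto _ X -> _]boolp.funext do rewrite addr0.
  apply: (propto_app1 (oner_neq0 K) _ meas_amp) => x.
  rewrite !big_ord2 !ffunE /= !mxE.
  move: (B _ _) (x qA) (x qAe) (x qCe) => b.
  by do 3![apply: ord2_ind] => /=; ring.
(* On the support Ce equals A, so controlling by Ce amounts to controlling by A. *)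
have ctrlU_amp : propto (app2 (ctrl U) qCe qC psi3) (fun x =>
      (x qAe == bit a)%:R * B (x qBe1) (x qBe2) * (x qA == x qCe)%:R
      * ctrl_amp U psiA psiC (x qA) (x qC)).
  apply: (propto_app2 (oner_neq0 K) _ psi3_amp) => x.
  rewrite ctrl_ampE !big_ord2 !ffunE /= !ctrlE.
  move: (B _ _) (x qA) (x qAe) (x qCe) => b.
  by do 3![apply: ord2_ind] => /=; ring.
(* The Hadamard sum keeps only the old value A of Ce, which survives as the sign (-1)^(Ce A). *)
apply: (propto_app1 (sqrtC2_neq0 K) _ ctrlU_amp) => x.
rewrite !big_ord2 !ffunE /= !mxE.
move: (B _ _) (ctrl_amp U psiA psiC) (x qA) (x qCe) => b X.
by do 2![apply: ord2_ind] => /=; ring.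
Qed.

Lemma big_label6 (V : nmodType) (F : label 'I_6 -> V)
    (f : 'I_2 -> 'I_2 -> 'I_2 -> 'I_2 -> 'I_2 -> 'I_2 -> V) :
    (forall x, F x = f (x qA) (x qC) (x qAe) (x qBe1) (x qBe2) (x qCe)) ->
  \sum_x F x = \sum_a \sum_c \sum_ae \sum_b1 \sum_b2 \sum_ce f a c ae b1 b2 ce.
Proof.
move=> Ff; rewrite !pair_big /=.
pose h (t : 'I_2 * 'I_2 * 'I_2 * 'I_2 * 'I_2 * 'I_2) : label 'I_6 :=
  let: (a, c, ae, b1, b2, ce) := t in
  (* The list follows the numbering of the qubits, whereas the tuple puts the data qubits first. *)
  [ffun q : 'I_6 => nth 0 [:: a; ae; b1; b2; ce; c] q].
pose g (x : label 'I_6) := (x qA, x qC, x qAe, x qBe1, x qBe2, x qCe).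
have hK : cancel h g by case=> [[[[[a c] ae] b1] b2] ce]; rewrite /g !ffunE.
have gK : cancel g h.
  move=> x; apply/ffunP=> q; rewrite ffunE.
  by case: q => [[|[|[|[|[|[|//]]]]]] ltq] /=; congr (x _); apply: val_inj.
rewrite (reindex h) /=; last exact: onW_bij (Bijective hK gK).
apply: eq_bigr => -[[[[[a c] ae] b1] b2] ce] _ /=.
by rewrite Ff !ffunE.
Qed.

(** For each control bit the block, [1] or [U], preserves the norm of [psiC]; the norm of [psiA] is
    what remains. *)
Lemma ctrl_amp_unit (U : 'M[K]_2) psiA psiC :
    unit_ket psiA -> unit_ket psiC -> U \is unitarymx ->
  \sum_i \sum_j `|ctrl_amp U psiA psiC i j| ^+ 2 = 1.
Proof.
move=> A1 C1 /unit_ket_unitary/(_ C1) UC1; rewrite -[RHS]A1.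
apply: eq_bigr => i _.
under eq_bigr do rewrite ctrl_ampE normrM exprMn.
rewrite -mulr_sumr -[RHS]mulr1; congr (_ * _).
case: eqP => _; [rewrite -[RHS]C1|rewrite -[RHS]UC1]; apply: eq_bigr => j _.
  by rewrite (bigD1 j) //= eqxx mul1r big1 ?addr0 // => l /negPf jl;
    rewrite eq_sym jl mul0r.
by rewrite mxE.
Qed.

Lemma final_amp U psiA psiC (m1 m2 a c : bool) :
    unit_ket psiA -> unit_ket psiC -> U \is unitarymx ->
  exists2 k : K, `|k| ^+ 2 * 2 = 1 &
    forall x, final U psiA psiC m1 m2 a c x = k *
     ((x qAe == bit a)%:R * bell_amp K m1 m2 (x qBe1) (x qBe2)
      * (x qCe == bit c)%:R * ctrl_amp U psiA psiC (x qA) (x qC)).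
Proof.
move=> A1 C1 U1; set B := bell_amp K m1 m2.
(* The amplitudes before the last correction: Ce is now [c], so the sign is (-1)^(c A), which Z on A
   cancels when [c] is true. *)
pose T x := (x qAe == bit a)%:R * B (x qBe1) (x qBe2) * (x qCe == bit c)%:R
  * (-1) ^+ (c * x qA) * ctrl_amp U psiA psiC (x qA) (x qC).
(* Ae and Ce are fixed, and Be1 determines Be2 with an amplitude of modulus 1: the two values of Be1
   give the 2. *)
have T_norm : \sum_x `|T x| ^+ 2 = 2.
  rewrite (@big_label6 _ _ (fun i j ae b1 b2 ce => (ae == bit a)%:R
    * `|B b1 b2| ^+ 2 * (ce == bit c)%:R * `|ctrl_amp U psiA psiC i j| ^+ 2)).
    transitivity (2 * \sum_i \sum_j `|ctrl_amp U psiA psiC i j| ^+ 2);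
      last by rewrite ctrl_amp_unit ?mulr1.
    rewrite mulr_sumr; apply: eq_bigr => i _.
    rewrite mulr_sumr; apply: eq_bigr => j _; rewrite !big_ord2 !normr_bell_amp.
    by case: (a); case: (c); case: (m2) => /=; ring.
  move=> x; rewrite /T; move: (B _ _) (ctrl_amp _ _ _ _ _) => b X.
  rewrite !normrM !exprMn normrX normrN1 !expr1n mulr1 !normr_nat -!natrX.
  by rewrite !expnS expn0 !muln1 !mulnb !andbb.
have := teleport_amp U a (swapping_amp psiA psiC m1 m2).
rewrite -/B /final /SCST /=; set psi5 := app1 (hadamard K) _ _ => psi5_amp.
have meas_amp : propto (app1 (proj (ket K c)) qCe psi5) T.
  apply: (propto_app1 (oner_neq0 K) _ psi5_amp) => x.
  rewrite !big_ord2 !ffunE /= !proj_ketE /T.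
  move: (B _ _) (ctrl_amp U psiA psiC) (x qA) (x qCe) => b X.
  by case: (c); do 2![apply: ord2_ind] => /=; ring.
have [|k] := normalize_propto meas_amp; rewrite T_norm ?pnatr_eq0 // => k2 TE.
exists k => // x; rewrite /measure_comp /T in TE *.
case: c TE {T T_norm meas_amp} => TE; last by rewrite TE mul0n expr0 mulr1.
rewrite ffunE big_ord2 !TE !ffunE /= !mxE.
move: (B _ _) (ctrl_amp U psiA psiC) (x qA) (x qCe) => b X.
by do 2![apply: ord2_ind] => /=; rewrite ?mulr0n ?mulr1n; ring.
Qed.

Lemma reduced_final U psiA psiC (m1 m2 a c : bool) :
    unit_ket psiA -> unit_ket psiC -> U \is unitarymx ->
  reduced qA qC (final U psiA psiC m1 m2 a c) =
  proj (ctrl U *m (psiA *t psiC) : 'cV_(2 * 2)).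
Proof.
move=> A1 C1 U1; have [k k2 finalE] := final_amp m1 m2 a c A1 C1 U1.
apply/matrixP=> i j.
case: (mxtens_indexP i) (mxtens_indexP j) => {i}i1 i2 [{j}j1 j2].
rewrite projE -!/(ctrl_amp _ _ _ _ _) mxE mxtens_indexK big_mkcond /=.
set X := ctrl_amp U psiA psiC in finalE *.
set B := bell_amp K m1 m2 in finalE *.
(* The first two indicators encode the range of the partial trace. The conjugated factor keeps the
   ancilla bits, so [B] and [k] enter only through their squared moduli. *)
rewrite (@big_label6 _ _ (fun a' c' ae b1 b2 ce =>
  (a' == i1)%:R * (c' == i2)%:R * (ae == bit a)%:R * (ce == bit c)%:R
  * `|B b1 b2| ^+ 2 * (`|k| ^+ 2 * (X i1 i2 * (X j1 j2)^*)))).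
  transitivity (`|k| ^+ 2 * 2 * (X i1 i2 * (X j1 j2)^* )); last first.
    by rewrite k2 mul1r.
  rewrite !big_ord2 !normr_bell_amp.
  move: (`|k| ^+ 2) (X i1 i2) ((X j1 j2)^* ) => n y z.
  move: i1 i2; case: (a); case: (c); case: (m2);
    by do 2![apply: ord2_ind] => /=; ring.
move=> x; rewrite (can_eq (@mxtens_indexK 2 2)) xpair_eqE !finalE !ffunE /=.
case: eqP => [->|_]; last by rewrite !mul0r.
case: eqP => [->|_]; last by rewrite mulr0 !mul0r.
move: (B _ _) => b; rewrite !rmorphM /= !normCK !rmorph_nat.
case: eqP => _; last by rewrite !(mulr0, mul0r).
case: eqP => _; last by rewrite !(mulr0, mul0r).
by rewrite /=; ring.
Qed.

End Protocol.

Theorem mainTheorem2 (R : realType) (psiA psiC : 'cV[R[i]]_2) (U : 'M[R[i]]_2)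
    (psiA_unit : unit_ket psiA) (psiC_unit : unit_ket psiC)
    (U_unitary : U \is unitarymx) (m1 m2 a c : bool) :
  exists2 phi : 'cV[R[i]]_(2 * 2),
    eq_up_to_phase phi (ctrl U *m (psiA *t psiC)) &
    reduced qA qC (final U psiA psiC m1 m2 a c) = proj phi.
Proof.
(* The density matrix has already lost the phase of [k], so the phase 1 suffices. *)
exists (ctrl U *m (psiA *t psiC)); last exact: reduced_final.
by exists 1; rewrite ?normr1 ?scale1r.
Qed.
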